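(* Let $T(\alpha,\beta,\gamma)=\left(\frac{\beta+\gamma}{2},\frac{\alpha+\gamma}{2},\frac{\alpha+\beta}{2}\right)$ on the set $\{(\alpha,\beta,\gamma)\in(0,\pi)^3:\alpha+\beta+\gamma=\pi\}$. The convergence speed of the transformation $T^2=T\circ T$ is linear with a convergence rate of $\frac14$.
   Context: The triples $(\alpha,\beta,\gamma)\in(0,\pi)^3$ with $\alpha+\beta+\gamma=\pi$ are the inner angles of non-degenerate planar triangles, considered up to similarity. The convergence referred to is that of the iterates of the transformation, applied to such a triple, to the equilateral triple $\left(\frac{\pi}{3},\frac{\pi}{3},\frac{\pi}{3}\right)$. *)

(* Defs.v *)
(* Stdlib reals and Coquelicot. *)
From Stdlib Require Export Reals.
From Coquelicot Require Export Coquelicot.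
Open Scope R_scope.

Definition triple : Type := (R * R * R)%type.

Definition is_triangle (x : triple) : Prop :=
  let '(alpha, beta, gamma) := x in
  (0 < alpha < PI) /\ (0 < beta < PI) /\ (0 < gamma < PI) /\
  alpha + beta + gamma = PI.

Definition equilateral : triple := (PI / 3, PI / 3, PI / 3).

Definition T (x : triple) : triple :=
  let '(alpha, beta, gamma) := x in
  ((beta + gamma) / 2, (alpha + gamma) / 2, (alpha + beta) / 2).

(* Linear convergence with rate mu, in the sense of
   lim |u (n+1) - l| / |u n - l| = mu with 0 < mu < 1.  The third clause
   keeps the quotients away from the division 0 / 0. *)
Definition seq_linear_convergence {V : NormedModule R_AbsRing}
    (u : nat -> V) (l : V) (mu : R) : Prop :=
  0 < mu < 1 /\
  filterlim u eventually (locally l) /\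
  eventually (fun n => u n <> l) /\
  is_lim_seq (fun n => norm (minus (u (S n)) l) / norm (minus (u n) l)) mu.

(* F is a self-map of D whose iterates converge to l from every starting point;
   a rate is only meaningful when the starting point is not l itself.
   On R * R * R, Coquelicot's [norm] is the Euclidean norm. *)
Definition map_linear_convergence {V : NormedModule R_AbsRing}
    (D : V -> Prop) (F : V -> V) (l : V) (mu : R) : Prop :=
  (forall x, D x -> D (F x)) /\
  (forall x, D x ->
     filterlim (fun n => Nat.iter n F x) eventually (locally l)) /\
  (forall x, D x -> x <> l ->
     seq_linear_convergence (fun n => Nat.iter n F x) l mu).

(* Main.v *)
Require Import Defs.
From Stdlib Require Import Lra.

(** On triangles, [T] sends each angle [a] to [(PI - a) / 2], so it multiplies
    the deviation [a - PI / 3] by [- 1 / 2]; hence [T] composed with itself is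
    exactly the homothety of ratio [1 / 4] centred at the equilateral triple
    ([deviation_TT]).  The orbit of a homothety of ratio [mu] is explicit: its
    deviation after [n] steps is [mu ^ n] times the initial one
    ([iter_homothety]).  When [0 < mu < 1] this tends to [0], never vanishes
    unless it does so initially, and the quotients of successive norms are not
    just asymptotically but constantly equal to [mu]. *)

(** * Homotheties on an invariant domain *)

(** Invariance of the domain is what lets the relation be applied at each
    iterate; the deviations themselves just form a geometric sequence. *)
Lemma iter_homothety {V : NormedModule R_AbsRing} (D : V -> Prop) (F : V -> V)
    (l : V) (mu : R) :
  (forall x, D x -> D (F x)) ->
  (forall x, D x -> minus (F x) l = scal mu (minus x l)) ->
  forall x n, D x ->
  D (Nat.iter n F x) /\
  minus (Nat.iter n F x) l = scal (mu ^ n) (minus x l).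
Proof.
intros HD HF x n Dx.
induction n as [|n [Dn En]]; simpl.
- split; [exact Dx|]. symmetry. exact (scal_one (minus x l)).
- split; [now apply HD|].
  rewrite (HF _ Dn), En. exact (scal_assoc mu (mu ^ n) (minus x l)).
Qed.

Lemma plus_minus_cancel {G : AbelianGroup} (x l : G) :
  plus l (minus x l) = x.
Proof.
unfold minus.
now rewrite (plus_comm x), plus_assoc, plus_opp_r, plus_zero_l.
Qed.

Lemma geometric_deviation_cvg {V : NormedModule R_AbsRing} (u : nat -> V)
    (l d : V) (mu : R) :
  Rabs mu < 1 ->
  (forall n, minus (u n) l = scal (mu ^ n) d) ->
  filterlim u eventually (locally l).
Proof.
intros Hmu Hu.
apply filterlim_ext with (fun n => plus l (scal (mu ^ n) d)).
  intros n. rewrite <- Hu. exact (plus_minus_cancel (u n) l).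
replace (locally l) with (locally (plus l zero))
  by (f_equal; exact (plus_zero_r l)).
eapply filterlim_comp_2;
  [apply filterlim_const | | apply filterlim_plus].
replace (@zero V) with (scal (0 : R) d) by exact (scal_zero_l d).
apply (filterlim_comp _ _ _ (fun n => mu ^ n) (fun k : R => scal k d)
         _ (locally (0 : R))).
- exact (is_lim_seq_geom mu Hmu).
- exact (filterlim_scal_l (K := R_AbsRing) (V := V) 0 d).
Qed.

(** A normed module is only required to satisfy the upper bound; applying that
    bound to the inverse scalar gives the other inequality. *)
Lemma norm_scal_pos {V : NormedModule R_AbsRing} (k : R) (x : V) :
  0 < k -> norm (scal k x) = k * norm x.
Proof.
intros Hk.
assert (Hle : forall (c : R) (y : V), 0 < c -> norm (scal c y) <= c * norm y).
{ intros c y Hc. rewrite <- (Rabs_pos_eq c) at 2 by lra.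
  exact (norm_scal (K := R_AbsRing) c y). }
assert (Hk' : 0 < / k) by now apply Rinv_0_lt_compat.
apply Rle_antisym; [now apply Hle |].
assert (Ex : scal (/ k) (scal k x) = x).
{ transitivity (scal (/ k * k) x).
  - exact (scal_assoc (/ k) k x).
  - rewrite Rinv_l by lra. exact (scal_one x). }
assert (Hx := Hle (/ k) (scal k x) Hk'). rewrite Ex in Hx.
apply Rmult_le_reg_l with (/ k); [exact Hk' |].
rewrite <- Rmult_assoc, Rinv_l, Rmult_1_l; [exact Hx | lra].
Qed.

(** For a nonzero initial deviation every norm in the orbit is positive, so
    the quotient of successive norms simplifies to [mu] at every step. *)
Lemma homothety_linear_convergence {V : NormedModule R_AbsRing}
    (D : V -> Prop) (F : V -> V) (l : V) (mu : R) :
  0 < mu < 1 ->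
  (forall x, D x -> D (F x)) ->
  (forall x, D x -> minus (F x) l = scal mu (minus x l)) ->
  map_linear_convergence D F l mu.
Proof.
intros Hmu HD HF.
assert (Hgeom : forall x, D x -> forall n,
  minus (Nat.iter n F x) l = scal (mu ^ n) (minus x l)).
{ intros x Dx n. now apply (iter_homothety D F l mu HD HF). }
assert (Hcvg : forall x, D x ->
  filterlim (fun n => Nat.iter n F x) eventually (locally l)).
{ intros x Dx. apply geometric_deviation_cvg with (minus x l) mu.
  - rewrite Rabs_pos_eq; lra.
  - now apply Hgeom. }
split; [exact HD | split; [exact Hcvg |]].
intros x Dx Hx.
assert (Hpos : forall n, 0 < norm (minus (Nat.iter n F x) l)).
{ intros n.
  assert (Hn : 0 < mu ^ n) by (apply pow_lt; lra).
  rewrite (Hgeom x Dx n), norm_scal_pos by exact Hn.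
  apply Rmult_lt_0_compat.
  - exact Hn.
  - apply norm_gt_0. intros E. apply Hx.
    transitivity (plus l (minus x l)).
    + symmetry. exact (plus_minus_cancel x l).
    + rewrite E. exact (plus_zero_r l). }
split; [exact Hmu | split; [now apply Hcvg | split]].
- exists 0%nat. intros n _ E. specialize (Hpos n).
  rewrite E, minus_eq_zero in Hpos.
  apply (Rlt_not_eq _ _ Hpos). symmetry. exact (norm_zero (V := V)).
- apply is_lim_seq_ext with (fun _ => mu); [| apply is_lim_seq_const].
  intros n. specialize (Hpos n). simpl Nat.iter.
  rewrite (HF (Nat.iter n F x)) by now apply (iter_homothety D F l mu HD HF).
  rewrite norm_scal_pos by lra.
  field. lra.
Qed.

(** * The triangle transformation *)

Lemma T_triangle (x : triple) : is_triangle x -> is_triangle (T x).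
Proof.
destruct x as [[a b] c]. unfold is_triangle, T. lra.
Qed.

(** The angle sum [a + b + c = PI] turns the new first angle
    [(2 * a + b + c) / 4] into [(a + PI) / 4], whose deviation from [PI / 3] is
    [(a - PI / 3) / 4]; likewise for the other two angles. *)
Lemma deviation_TT (x : triple) :
  is_triangle x ->
  minus (T (T x)) equilateral = scal (1 / 4) (minus x equilateral).
Proof.
destruct x as [[a b] c]. unfold is_triangle. intros H.
apply injective_projections; [apply injective_projections |];
  cbv -[Rplus Rmult Ropp Rinv Rdiv IZR PI]; lra.
Qed.

Theorem mainTheorem4 :
  (forall x : triple, is_triangle x -> is_triangle (T x)) /\
  map_linear_convergence is_triangle (fun x : triple => T (T x))
    equilateral (1 / 4).
Proof.
split; [exact T_triangle |].
apply homothety_linear_convergence.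
- lra.
- intros x Hx. now apply T_triangle, T_triangle.
- exact deviation_TT.
Qed.
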